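(* Let $\mathsf V$ be a pseudovariety of semigroups containing $\mathcal{L}\mathsf{Sl}$, let $A$ be an alphabet, let $e$ be an idempotent of $\widehat F_{\mathsf V}(A)$, and let $J_e$ be the $\mathcal J$-class of $e$ in $\widehat F_{\mathsf V}(A)$. The following conditions are equivalent: (1) $e=u^\omega$ for some $u\in A^+$; (2) $J_e$ contains a finite number of $\mathcal H$-classes; (3) $J_e$ contains a finite number of $\mathcal R$-classes; (4) $J_e$ contains a finite number of $\mathcal L$-classes; (5) $J_e$ contains a finite number of idempotents.
   Context: Alphabets are finite nonempty sets; $A^+$ is the free semigroup on $A$. A pseudovariety of semigroups is a class of finite semigroups closed under subsemigroups, homomorphic images and finite direct products. $\mathcal L\mathsf{Sl}$ is the class of finite semigroups $S$ such that $fSf$ is a semilattice (commutative, all elements idempotent) for every idempotent $f$ of $S$. $\widehat F_{\mathsf V}(A)$ is the free pro-$\mathsf V$ semigroup on $A$, i.e. the inverse limit of the finite quotients of $A^+$ belonging to $\mathsf V$; if $\mathsf V\supseteq\mathcal L\mathsf{Sl}$, $A^+$ embeds in it as a dense subsemigroup of isolated points. For an element $s$ of a compact semigroup, $s^\omega$ denotes the unique idempotent in the closed subsemigroup generated by $s$. $\mathcal R,\mathcal L,\mathcal H,\mathcal J$ are Green's relations of the semigroup $\widehat F_{\mathsf V}(A)$. *)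

(* Defs.v *)
From HB Require Import structures.
From mathcomp Require Import all_boot.
From mathcomp Require Import all_classical.
From mathcomp Require Import topology.

Set Implicit Arguments.
Unset Strict Implicit.
Unset Printing Implicit Defensive.

Import Algebra.

Local Open Scope classical_set_scope.
Local Open Scope group_scope.
Local Open Scope quotient_scope.

Definition semigroup_prod (I : Type) (S : I -> semigroupType) : Type :=
  forall i, S i.

Section SemigroupProd.
Variables (I : Type) (S : I -> semigroupType).

HB.instance Definition _ := Choice.copy (semigroup_prod S) (forall i, S i).

Definition semigroup_prod_mul (x y : semigroup_prod S) : semigroup_prod S :=
  fun i => x i * y i.

Lemma semigroup_prod_mulA : associative semigroup_prod_mul.
Proof.
by move=> x y z; apply: functional_extensionality_dep => i; exact: mulgA.
Qed.

HB.instance Definition _ :=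
  isSemigroup.Build (semigroup_prod S) semigroup_prod_mulA.

End SemigroupProd.

(* Classes of finite semigroups are predicates on [semigroupType].  The empty  *)
(* semigroup is not excluded; this is harmless, because it is not a quotient   *)
(* of A^+ when the alphabet A is nonempty.                                     *)

Record pseudovariety (V : semigroupType -> Prop) : Prop := Pseudovariety {
  pseudovariety_finite : forall S, V S -> finite_set [set: S];
  pseudovariety_sub :
    forall (S T : semigroupType) (f : {multiplicative S -> T}),
      injective f -> V T -> V S;
  pseudovariety_quo :
    forall (S T : semigroupType) (f : {multiplicative S -> T}),
      range f = [set: T] -> V S -> V T;
  pseudovariety_prod :
    forall (I : finType) (S : I -> semigroupType),
      (forall i, V (S i)) -> V (semigroup_prod S)
}.

Section Idempotents.
Variable S : semigroupType.
Implicit Types (e f x y : S) (B : set S).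

Definition is_idempotent e := e * e = e.

Definition semilattice_set B :=
  (forall x y, B x -> B y -> x * y = y * x) /\ (forall x, B x -> is_idempotent x).

Definition local_set f : set S := [set f * s * f | s in [set: S]].

End Idempotents.

Definition LSl (S : semigroupType) : Prop :=
  finite_set [set: S] /\
  forall f : S, is_idempotent f -> semilattice_set (local_set f).

(* Green's relations: two elements are related when they generate the same     *)
(* right, left or two-sided ideal; S^1 is expanded, so that no unit is needed. *)

Section Green.
Variable S : semigroupType.
Implicit Types x y : S.

Definition right_ideal x : set S := [set x] `|` [set x * t | t in [set: S]].

Definition left_ideal x : set S := [set x] `|` [set s * x | s in [set: S]].

Definition twosided_ideal x : set S :=
  right_ideal x `|` left_ideal x `|`
  [set z | exists s t, z = s * x * t].

Definition greenR x y := right_ideal x = right_ideal y.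
Definition greenL x y := left_ideal x = left_ideal y.
Definition greenH x y := greenR x y /\ greenL x y.
Definition greenJ x y := twosided_ideal x = twosided_ideal y.

Definition Rclass x : set S := [set y | greenR x y].
Definition Lclass x : set S := [set y | greenL x y].
Definition Hclass x : set S := [set y | greenH x y].
Definition Jclass x : set S := [set y | greenJ x y].

End Green.

Record congruence (S : semigroupType) := Congruence {
  congruence_rel :> equiv_rel S;
  congruenceM : forall x y z t,
    congruence_rel x y -> congruence_rel z t -> congruence_rel (x * z) (y * t)
}.

Definition cquot (S : semigroupType) (c : congruence S) : Type := {eq_quot c}.

Section CQuot.
Variables (S : semigroupType) (c : congruence S).

HB.instance Definition _ := Choice.on (cquot c).
HB.instance Definition _ := EqQuotient.on (cquot c).

Definition cquot_mul : cquot c -> cquot c -> cquot c :=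
  fun p q => \pi_(cquot c) (repr p * repr q).

Lemma cquot_piE x y : (\pi_(cquot c) x = \pi_(cquot c) y) <-> c x y.
Proof. by rewrite -(rwP (eqmodP _ x y)). Qed.

Lemma cquot_pi_mul x y :
  cquot_mul (\pi x) (\pi y) = \pi_(cquot c) (x * y).
Proof.
by apply/cquot_piE/congruenceM; apply/cquot_piE; rewrite reprK.
Qed.

Lemma cquot_mulA : associative cquot_mul.
Proof.
move=> p q r; rewrite -[p]reprK -[q]reprK -[r]reprK.
by rewrite !cquot_pi_mul mulgA.
Qed.

HB.instance Definition _ := isSemigroup.Build (cquot c) cquot_mulA.

End CQuot.

(* The free semigroup A^+ consists of the nonempty words on A. *)
Definition word (A : finType) : Type := {w : seq A | w != [::]}.

Section Word.
Variable A : finType.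

HB.instance Definition _ := Choice.on (word A).

Lemma word_mul_subproof (u v : word A) : val u ++ val v != [::].
Proof. by case: u => -[]. Qed.

Definition word_mul (u v : word A) : word A :=
  Sub (val u ++ val v) (word_mul_subproof u v).

Lemma word_mulA : associative word_mul.
Proof. by move=> u v w; apply: val_inj; exact: catA. Qed.

HB.instance Definition _ := isSemigroup.Build (word A) word_mulA.

End Word.

(* The free pro-V semigroup: the limit of the inverse system formed by the     *)
(* finite quotients of A^+ lying in V, as a subspace of their product, each    *)
(* quotient being discrete.                                                    *)

Section FreeProV.
Variables (V : semigroupType -> Prop) (A : finType).

Definition Vcongruence : Type := {c : congruence (word A) | V (cquot c)}.

Definition Vquot (c : Vcongruence) : semigroupType := cquot (sval c).

Definition finer (c d : Vcongruence) :=
  forall u v : word A, sval c u v -> sval d u v.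

Definition transition (c d : Vcongruence) (p : Vquot c) : Vquot d :=
  \pi_(cquot (sval d)) (repr (p : cquot (sval c))).

Definition compatible :
    set (prod_topology (fun c => discrete_topology (Vquot c))) :=
  [set x | forall c d, finer c d -> transition d (x c) = x d].

Definition free_proV : Type := set_type compatible.

HB.instance Definition _ := Topological.on free_proV.

Definition to_quot (x : free_proV) (c : Vcongruence) : Vquot c := val x c.

Lemma to_quotP x : compatible (to_quot x).
Proof. exact: set_mem (valP x). Qed.

Lemma to_quot_inj x y : (forall c, to_quot x c = to_quot y c) -> x = y.
Proof.
by move=> xy; apply: val_inj; apply: functional_extensionality_dep.
Qed.

Lemma transition_pi c d u : finer c d ->
  transition d (\pi_(cquot (sval c)) u) = \pi_(cquot (sval d)) u.
Proof.
by move=> cd; apply/cquot_piE/cd; apply/cquot_piE; rewrite reprK.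
Qed.

Lemma transitionM c d : finer c d ->
  {morph @transition c d : p q / p * q}.
Proof.
move=> cd p q; rewrite -[p](@reprK _ (cquot (sval c))).
rewrite -[q](@reprK _ (cquot (sval c))).
have piM b (x y : word A) : (\pi_(cquot (sval b)) x : Vquot b) *
    (\pi_(cquot (sval b)) y : Vquot b) = \pi_(cquot (sval b)) (x * y).
  exact: cquot_pi_mul.
by rewrite piM !transition_pi // piM.
Qed.

Lemma free_proV_mul_subproof x y :
  compatible (fun c => to_quot x c * to_quot y c).
Proof. by move=> c d cd; rewrite transitionM// !to_quotP. Qed.

Definition free_proV_mul (x y : free_proV) : free_proV :=
  exist (fun z => z \in compatible) _ (mem_set (free_proV_mul_subproof x y)).

Lemma free_proV_mulA : associative free_proV_mul.
Proof. by move=> x y z; apply: to_quot_inj => c; exact: mulgA. Qed.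

HB.instance Definition _ := isSemigroup.Build free_proV free_proV_mulA.

Lemma of_word_subproof (u : word A) :
  compatible (fun c => \pi_(cquot (sval c)) u).
Proof. by move=> c d cd; exact: transition_pi. Qed.

(* The canonical map A^+ -> free_proV, an embedding when V contains LSl. *)
Definition of_word (u : word A) : free_proV :=
  exist (fun z => z \in compatible) _ (mem_set (of_word_subproof u)).

Lemma of_wordM : {morph of_word : u v / u * v}.
Proof. by move=> u v; apply: to_quot_inj => c; exact/esym/cquot_pi_mul. Qed.

HB.instance Definition _ := isMultiplicative.Build _ _ of_word of_wordM.

Definition closed_subsemigroup (s : free_proV) : set free_proV :=
  smallest
    [set B | closed B /\ forall x y : free_proV, B x -> B y -> B (x * y)]
    [set s].

(* When V is a pseudovariety, free_proV is a compact semigroup, so that such   *)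
(* an idempotent exists and is unique: the default value of [xget] is unused.  *)
Definition omega (s : free_proV) : free_proV :=
  xget s [set f | closed_subsemigroup s f /\ is_idempotent f].

End FreeProV.

(* Main.v *)
(* Compactness of the free pro-V semigroup enters only through limits along an
   ultrafilter U on the directed set of V-congruences: a factorization found at
   every level of the inverse system passes to the limit.  Since V contains LSl,
   the prefix and suffix of length n and the set of factors of length n of a
   pseudoword are well defined.

   If e = u^omega and x is J-equivalent to e, then words approximating x are
   segments of the periodic word uuu..., and the start and the length modulo |u|
   of the segment determine the H-class of x: there are finitely many.

   Conversely, a factor z of e gives a factorization e = a z b, whence idempotents
   z b e a and b e a z in J_e with prefix, resp. suffix, z.  So if one of the four
   sets is finite, the number of factors of e of length n is bounded in n.
   As in the Morse-Hedlund theorem, for some n each factor of length n then has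
   exactly one extension of length n + 1, so the words w approximating e are
   prefixes of one infinite word p; as e = e e, so are their powers.  Then |w| is a
   period of p, w is a power of the shortest period v of p, and e = v^omega. *)

From HB Require Import structures.
Require Import Defs.
From mathcomp Require Import all_boot all_classical topology.
From mathcomp Require Import finmap zify.

Set Implicit Arguments.
Unset Strict Implicit.
Unset Printing Implicit Defensive.

Import Algebra.

Local Open Scope classical_set_scope.

(** * Segments of infinite words *)

Section Sequences.
Variable T : eqType.
Implicit Types (n i k : nat) (s u v w z : seq T) (p : nat -> T).

Definition last_take n s := rev (take n (rev s)).

Lemma take_cat_take n u v : take n (u ++ v) = take n (take n u ++ take n v).
Proof.
case: (leqP n (size u)) => nu.
  by rewrite takel_cat// take_size_cat// size_takel.
rewrite (take_oversize (ltnW nu)) !take_cat !ltnNge (ltnW nu)/=.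
by rewrite take_takel ?leq_subr.
Qed.

Lemma last_take_cat n u v :
  last_take n (u ++ v) = last_take n (last_take n u ++ last_take n v).
Proof. by rewrite /last_take !rev_cat take_cat_take !revK. Qed.

Lemma last_takel_cat n u v : n <= size v -> last_take n (u ++ v) = last_take n v.
Proof. by move=> nv; rewrite /last_take rev_cat takel_cat ?size_rev. Qed.

Lemma last_take_suffix n u v : size v <= n ->
  exists s, last_take n (u ++ v) = s ++ v.
Proof.
move=> vn; rewrite /last_take rev_cat take_cat size_rev ltnNge vn/=.
by rewrite rev_cat revK; eexists.
Qed.

(** An occurrence of [z] meeting both [u] and [v] stays within the last [n] letters of [u] and the
    first [n] of [v], so the factors of a product depend only on bounded data of its terms. *)
Lemma infix_catE n u v z : size z = n ->
  infix z (u ++ v) =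
  [|| infix z u, infix z v | infix z (last_take n u ++ take n v)].
Proof.
move=> zn; apply/idP/or3P => [|[]]; first last.
- case/infixP => s [s' E]; have -> : u ++ v =
    rev (drop n (rev u)) ++ (last_take n u ++ take n v) ++ drop n v.
    by rewrite -catA cat_take_drop catA -rev_cat cat_take_drop revK.
  by rewrite E -!catA; apply/infix_catl/infix_infix.
- exact: infix_catl.
- exact: infix_catr.
case/infixP => s [s' E].
case: (leqP (size s + size z) (size u)) => szu.
  constructor 1; have := congr1 (take (size s + size z)) E.
  rewrite takel_cat// catA take_size_cat ?size_cat// => E'.
  by rewrite -(cat_take_drop (size s + size z) u) E' -catA infix_infix.
case: (leqP (size u) (size s)) => us.
  constructor 2; have := congr1 (drop (size u)) E.
  rewrite drop_size_cat// => ->; rewrite -(cat_take_drop (size u) s) -catA.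
  by rewrite drop_size_cat ?size_takel ?infix_infix.
constructor 3.
have us' : take (size s) u = s.
  by have := congr1 (take (size s)) E; rewrite takel_cat 1?ltnW// take_size_cat.
have Eu := cat_take_drop (size s) u; rewrite us' in Eu.
set x := drop (size s) u in Eu.
have {}E : x ++ v = z ++ s'.
  by move: E; rewrite -Eu -catA => /eqP; rewrite eqseq_cat// eqxx/= => /eqP.
have xz : size x <= size z.
  by move: szu; rewrite -Eu size_cat ltn_add2l => /ltnW.
have zx : z = x ++ take (size z - size x) v.
  by have := congr1 (take (size z)) E; rewrite take_cat ltnNge xz take_size_cat.
have [|t Et] := @last_take_suffix n s x; first by rewrite -zn.
rewrite -Eu Et -catA; apply: infix_catl.
have -> : take n v = take (size z - size x) v ++ drop (size z - size x) (take n v).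
  by rewrite -{1}(cat_take_drop (size z - size x) (take n v)) take_takel// -zn leq_subr.
by rewrite catA -zx; exact: prefix_infix.
Qed.

Definition segment p i k := mkseq (fun j => p (i + j)) k.

Lemma size_segment p i k : size (segment p i k) = k.
Proof. exact: size_mkseq. Qed.

Lemma segment_cat p i k l :
  segment p i (k + l) = segment p i k ++ segment p (i + k) l.
Proof.
rewrite /segment /mkseq iotaD map_cat; congr (_ ++ _).
by rewrite add0n -[X in iota X]addn0 iotaDl -map_comp; apply: eq_map => j /=; rewrite addnA.
Qed.

Definition period p k := forall t, p (t + k) = p t.

Lemma period_mul p k q : period p k -> period p (q * k).
Proof.
move=> pk t; elim: q => [|q IH]; first by rewrite addn0.
by rewrite mulSn addnCA addnC pk.
Qed.

Lemma period_mod p k l : period p k -> period p l -> period p (l %% k).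
Proof.
move=> pk pl t; rewrite -[LHS](period_mul (l %/ k) pk) -addnA.
by rewrite [X in t + X]addnC -divn_eq pl.
Qed.

Lemma segment_period p i j k l : period p k ->
  i = j %[mod k] -> segment p i l = segment p j l.
Proof.
move=> pk ij; have pm t : p (t %% k) = p t.
  by rewrite {2}(divn_eq t k) addnC (period_mul _ pk).
apply: eq_mkseq => t; rewrite -(pm (i + t)) -(pm (j + t)).
by congr p; apply/eqP; rewrite eqn_modDr ij.
Qed.

Lemma segment_pow p k q : period p k ->
  segment p 0 (q * k) = flatten (nseq q (segment p 0 k)).
Proof.
move=> pk; elim: q => //= q <-.
by rewrite mulSn segment_cat (@segment_period p (0 + k) 0 k)// modnn mod0n.
Qed.

Lemma infix_segment p i k z : infix z (segment p i k) ->
  exists j, z = segment p j (size z).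
Proof.
case/infixP => s [s' E]; exists (i + size s).
have : size s + size z <= k.
  by rewrite -(size_segment p i k) E !size_cat addnA leq_addr.
move=> /subnKC Ek; move: E; rewrite -Ek !segment_cat -catA => /eqP.
by rewrite eqseq_cat ?size_segment// eqseq_cat ?size_segment// => /and3P[_ /eqP].
Qed.

(** Induction along [w]: the window of length [n.+1] ending at the next letter begins with [n]
    letters already known to agree with [p], and these force its last letter. *)
Lemma segment_prefix p n w : take n w = segment p 0 n ->
    (forall z j, size z = n.+1 -> infix z w ->
       take n z = segment p j n -> z = segment p j n.+1) ->
  w = segment p 0 (size w).
Proof.
move=> wn wz.
suff H j : j <= size w -> take j w = segment p 0 j.
  by rewrite -H ?take_size.
elim: j => [|j IH jw]; first by rewrite take0.
have {}IH := IH (ltnW jw).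
case: (ltnP j n) => jn.
  rewrite -(take_takel _ jn) wn -{1}(subnKC jn) segment_cat take_size_cat//.
  exact: size_segment.
move: IH jw; rewrite -(subnK jn); set m := j - n => IH jw.
move: IH; rewrite takeD segment_cat => /eqP.
have mw : size (take m w) = m.
  by rewrite size_takel// (leq_trans _ (ltnW jw))// leq_addr.
rewrite eqseq_cat ?mw ?size_segment// => /andP[/eqP Em /eqP En].
rewrite -addnS takeD segment_cat Em; congr (_ ++ _).
apply: wz; last by rewrite take_takel.
- by rewrite size_takel// size_drop ltn_subRL.
- apply/infixP; exists (take m w), (drop n.+1 (drop m w)).
  by rewrite !cat_take_drop.
Qed.

Lemma flatten_nseqD m n w :
  flatten (nseq (m + n) w) = flatten (nseq m w) ++ flatten (nseq n w).
Proof. by rewrite nseqD flatten_cat. Qed.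

Lemma flatten_nseqM m n w :
  flatten (nseq m (flatten (nseq n w))) = flatten (nseq (m * n) w).
Proof. by elim: m => // m IH; rewrite mulSn flatten_nseqD -IH. Qed.

Lemma size_flatten_nseq n w : size (flatten (nseq n w)) = n * size w.
Proof. by elim: n => //= n IH; rewrite size_cat IH mulSn. Qed.

End Sequences.

(** * Periods of infinite words *)

Section Periods.
Variables (T : eqType) (p : nat -> T).
Implicit Types (i j k l t : nat) (w : seq T).

Lemma take_segment i k l : l <= k -> take l (segment p i k) = segment p i l.
Proof.
by move=> lk; rewrite -(subnKC lk) segment_cat take_size_cat ?size_segment.
Qed.

Lemma segment_infix i k l : i + k <= l -> infix (segment p i k) (segment p 0 l).
Proof.
by move=> ikl; rewrite -(subnKC ikl) !segment_cat add0n -catA infix_infix.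
Qed.

(** Deleting the first copy of [w] from a power shifts [p] by [size w] and leaves a shorter power,
    again a prefix of [p]. *)
Lemma flatten_nseq_period w :
  (forall m, flatten (nseq m w) = segment p 0 (m * size w)) -> period p (size w).
Proof.
move=> wp t.
have H : segment p (size w) (t.+1 * size w) = segment p 0 (t.+1 * size w).
  have := wp t.+2; rewrite mulSn segment_cat add0n [LHS]/= => /eqP.
  rewrite eqseq_cat ?size_segment// => /andP[_ /eqP <-].
  by rewrite -wp.
have [->|w0] := posnP (size w); first by rewrite addn0.
have tw : t < t.+1 * size w by rewrite (leq_trans (ltnSn t))// leq_pmulr.
have := congr1 (fun s => nth (p 0) s t) H.
by rewrite !nth_mkseq// add0n addnC.
Qed.

(** The remainder of a period modulo the least positive period is again a period, hence zero. *)
Lemma minimal_period k : 0 < k -> period p k ->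
  exists2 k0, 0 < k0 & period p k0 /\ forall l, period p l -> k0 %| l.
Proof.
move=> k_gt0 pk; have ex : exists n, (0 < n) && `[< period p n >].
  by exists k; rewrite k_gt0; apply/asboolP.
case: (ex_minnP ex) => m /andP[m_gt0 /asboolP pm] mmin.
exists m => //; split=> // l pl; rewrite /dvdn -leqn0 leqNgt; apply/negP => lm.
have := mmin (l %% m); rewrite lm/= leqNgt ltn_pmod//= => /(_ _)/notF; apply.
by apply/asboolP/period_mod.
Qed.

End Periods.

Section Periodic.
Variables (T : eqType) (x0 : T) (w : seq T).

Definition periodic_seq i := nth x0 w (i %% size w).

Lemma periodic_seq_period : period periodic_seq (size w).
Proof. by move=> t; rewrite /periodic_seq modnDr. Qed.

Lemma segment_periodic_seq m :
  segment periodic_seq 0 (m * size w) = flatten (nseq m w).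
Proof.
rewrite segment_pow; last exact: periodic_seq_period.
congr (flatten (nseq m _)); apply: (@eq_from_nth _ x0); rewrite size_segment// => i iw.
by rewrite nth_mkseq// /periodic_seq add0n modn_small.
Qed.

End Periodic.

(** The bound [r] is fixed before [X], [Z] and [R]: it will serve for the factors of every length at
    once. *)
Lemma card_le_finite_set (T : choiceType) (D : set T) : finite_set D ->
  exists r, forall (X : finType) (Z : {set X}) (R : X -> T -> Prop),
    (forall z, z \in Z -> exists2 t, D t & R z t) ->
    (forall z z' t, R z t -> R z' t -> z = z') -> #|Z| <= r.
Proof.
move=> /finite_fsetP[E ->]; exists (size (enum_fset E)) => X Z R ZR Rinj.
have [->|[z0 z0Z]] := set_0Vmem Z; first by rewrite cards0.
have [t0 _ _] := ZR _ z0Z.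
have [f fP] : {f : X -> T & forall z, z \in Z -> [set` E] (f z) /\ R z (f z)}.
  apply: (@choice X T (fun z t => z \in Z -> [set` E] t /\ R z t)) => z.
  by case: (boolP (z \in Z)) => [/ZR[t Et Rt]|_]; [exists t | exists t0].
rewrite cardE -(size_map f); apply: uniq_leq_size.
  rewrite map_inj_in_uniq ?enum_uniq// => z z'; rewrite !mem_enum.
  by move=> /fP[_ Rz] /fP[_ Rz'] E'; apply: Rinj Rz _; rewrite E'.
by move=> _ /mapP[z + ->]; rewrite mem_enum => /fP[].
Qed.

Local Open Scope group_scope.
Local Open Scope quotient_scope.

(** * The congruences identifying words with the same prefixes, suffixes and factors *)

Lemma cquot_piM (S : semigroupType) (c : congruence S) (x y : S) :
  (\pi_(cquot c) x : cquot c) * (\pi_(cquot c) y : cquot c) = \pi_(cquot c) (x * y).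
Proof. exact: cquot_pi_mul. Qed.

Section FactorCongruence.
Variables (A : finType) (n : nat).
Implicit Types u v w : word A.

(** A word shorter than [n] is recorded in full by the first two components, and its third component
    is empty. *)
Definition factor_sig w : seq A * seq A * {set n.-tuple A} :=
  (take n (val w), last_take n (val w), [set z : n.-tuple A | infix z (val w)]%SET).

Lemma factor_sigP u v : factor_sig u = factor_sig v <->
  [/\ take n (val u) = take n (val v),
      last_take n (val u) = last_take n (val v) &
      forall z, size z = n -> infix z (val u) = infix z (val v)].
Proof.
split=> [[-> -> E]|[Et El Ei]].
  split=> // z /eqP zn; have /setP/(_ (Tuple zn)) := E.
  by rewrite !inE.
by congr (_, _, _) => //; apply/setP => z; rewrite !inE Ei ?size_tuple.
Qed.

Lemma val_mul u v : val (u * v) = val u ++ val v. Proof. by []. Qed.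

Lemma factor_sigM u v u' v' : factor_sig u = factor_sig u' ->
  factor_sig v = factor_sig v' -> factor_sig (u * v) = factor_sig (u' * v').
Proof.
move=> /factor_sigP[tu lu iu] /factor_sigP[tv lv iv].
apply/factor_sigP; rewrite !val_mul; split.
- by rewrite take_cat_take tu tv -take_cat_take.
- by rewrite last_take_cat lu lv -last_take_cat.
- by move=> z zn; rewrite [LHS](infix_catE _ _ zn) [RHS](infix_catE _ _ zn) iu// iv// lu tv.
Qed.

Definition factor_rel : rel (word A) := fun u v => factor_sig u == factor_sig v.

Lemma factor_rel_refl : reflexive factor_rel.
Proof. by move=> u; rewrite /factor_rel. Qed.

Lemma factor_rel_sym : symmetric factor_rel.
Proof. by move=> u v; rewrite /factor_rel eq_sym. Qed.

Lemma factor_rel_trans : transitive factor_rel.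
Proof. by move=> v u w /eqP uv /eqP vw; rewrite /factor_rel uv vw. Qed.

Definition factor_equiv : equiv_rel (word A) :=
  EquivRel factor_rel factor_rel_refl factor_rel_sym factor_rel_trans.

Lemma factor_equivM u u' v v' : factor_equiv u u' -> factor_equiv v v' ->
  factor_equiv (u * v) (u' * v').
Proof. by move=> /eqP uu' /eqP vv'; apply/eqP/factor_sigM. Qed.

Definition factor_congruence : congruence (word A) := Congruence factor_equivM.

Lemma factor_congruenceE u v :
  factor_congruence u v <-> factor_sig u = factor_sig v.
Proof. by split=> [/eqP|/eqP]. Qed.

Lemma factor_congruence_finite : finite_set [set: cquot factor_congruence].
Proof.
pose f (q : cquot factor_congruence) := factor_sig (repr q).
have fb q : size (f q).1.1 <= n /\ size (f q).1.2 <= n.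
  by rewrite size_rev !size_take_min !geq_minl.
pose g q : n.-bseq A * n.-bseq A * {set n.-tuple A} :=
  (Bseq (fb q).1, Bseq (fb q).2, (f q).2).
rewrite -(preimage_setT g); apply: finite_preimage; last exact: finite_finset.
move=> p q _ _ /= [E1 E2 E3]; rewrite -[p]reprK -[q]reprK.
apply/cquot_piE/factor_congruenceE; rewrite /factor_sig.
by congr (_, _, _).
Qed.

(** If [w] had fewer than [n] letters, truncating [w * w] to [n] letters would leave more than
    [w]. *)
Lemma idempotent_factor_sig w : factor_sig (w * w) = factor_sig w ->
  n <= size (val w).
Proof.
move=> /factor_sigP[+ _ _]; rewrite val_mul; case: leqP => // wn.
move=> /(congr1 size); rewrite !size_take_min size_cat.
have : 0 < size (val w) by case: w {wn} => -[].
lia.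
Qed.

(* A factor straddling the junction of w and w is a factor of w w, hence of w. *)
Lemma local_factor_infix w x y z : factor_sig (w * w) = factor_sig w ->
  size z = n ->
  infix z (x ++ val w ++ val w ++ y) = infix z (x ++ val w) || infix z (val w ++ y).
Proof.
move=> ww zn; have wn := idempotent_factor_sig ww.
have /factor_sigP[_ _ iw] := ww.
rewrite catA (infix_catE _ _ zn) last_takel_cat// takel_cat//.
rewrite orbA; apply/orb_idr => H; apply/orP; left.
by apply: infix_catl; rewrite -iw// val_mul (infix_catE _ _ zn) H !orbT.
Qed.

(** Local elements at the class of [w] are classes of words [w * s * w]. As [w] has at least [n]
    letters, they share prefix and suffix, and the factor set of a product is the union of the
    factor sets; union is commutative and idempotent. *)
Lemma factor_congruence_LSl : LSl (cquot factor_congruence).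
Proof.
split; first exact: factor_congruence_finite.
move=> f; rewrite -[f]reprK; set w := repr f => fi.
have ww : factor_sig (w * w) = factor_sig w.
  by apply/factor_congruenceE/cquot_piE; rewrite -cquot_piM.
have wn := idempotent_factor_sig ww.
have loc x : local_set (\pi_(cquot factor_congruence) w) x ->
    exists s, x = \pi_(cquot factor_congruence) (w * s * w).
  case=> s _ <-; exists (repr s); rewrite -[s in LHS]reprK.
  by rewrite -!cquot_piM.
have I s t z : size z = n -> infix z (val (w * s * w * (w * t * w))) =
    infix z (val (w * s * w)) || infix z (val (w * t * w)).
  move=> zn; rewrite !val_mul -!catA [in LHS]catA local_factor_infix//.
  by rewrite -!catA.
split=> [x y /loc[s ->] /loc[t ->]|x /loc[s ->]].
  rewrite !cquot_piM.
  apply/cquot_piE/factor_congruenceE/factor_sigP; split.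
  - by rewrite !val_mul -!catA !takel_cat.
  - by rewrite !val_mul !catA !last_takel_cat.
  - by move=> z zn; rewrite !I// orbC.
rewrite /is_idempotent cquot_piM.
apply/cquot_piE/factor_congruenceE/factor_sigP; split.
- by rewrite !val_mul -!catA !takel_cat.
- by rewrite !val_mul !catA !last_takel_cat.
- by move=> z zn; rewrite I// orbb.
Qed.
End FactorCongruence.

(** * The inverse system of V-congruences and its limit *)

Section Meet.
Variables (S : semigroupType) (c d : congruence S).

Definition meet_rel : rel S := fun x y => c x y && d x y.

Lemma meet_rel_refl : reflexive meet_rel.
Proof. by move=> x; rewrite /meet_rel !equiv_refl. Qed.

Lemma meet_rel_sym : symmetric meet_rel.
Proof. by move=> x y; rewrite /meet_rel equiv_sym (equiv_sym d). Qed.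

Lemma meet_rel_trans : transitive meet_rel.
Proof.
by move=> y x z /andP[cxy dxy] /andP[cyz dyz]; apply/andP; split;
  [exact: equiv_trans cyz | exact: equiv_trans dyz].
Qed.

Definition meet_equiv : equiv_rel S :=
  EquivRel meet_rel meet_rel_refl meet_rel_sym meet_rel_trans.

Lemma meet_equivM x y z t :
  meet_equiv x y -> meet_equiv z t -> meet_equiv (x * z) (y * t).
Proof.
by move=> /andP[? ?] /andP[? ?]; apply/andP; split; apply: congruenceM.
Qed.

Definition meet_congruence := Congruence meet_equivM.

Lemma meet_congruence_in V : pseudovariety V ->
  V (cquot c) -> V (cquot d) -> V (cquot meet_congruence).
Proof.
move=> hV Vc Vd.
pose Q b : semigroupType := if b then (cquot c : semigroupType) else (cquot d : semigroupType).
pose f (q : cquot meet_congruence) : semigroup_prod Q := fun b =>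
  if b as b return Q b then \pi_(cquot c) (repr q) else \pi_(cquot d) (repr q).
have fM : {morph f : p q / p * q}.
  move=> p q; have : meet_congruence (repr (p * q)) (repr p * repr q).
    by apply/cquot_piE; rewrite reprK -cquot_piM !reprK.
  case/andP => Ec Ed; apply: functional_extensionality_dep => -[].
  - by rewrite /f; apply: (etrans ((cquot_piE c _ _).2 Ec)); exact/esym/cquot_piM.
  - by rewrite /f; apply: (etrans ((cquot_piE d _ _).2 Ed)); exact/esym/cquot_piM.
pose F : {multiplicative cquot meet_congruence -> semigroup_prod Q} :=
  HB.pack f (isMultiplicative.Build _ _ f fM).
apply: (pseudovariety_sub hV (f := F)); last first.
  by apply: pseudovariety_prod => //; case.
move=> p q E; rewrite -[p]reprK -[q]reprK; apply/cquot_piE/andP; split.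
- by apply/cquot_piE; exact: (congr1 (fun g => g true) E).
- by apply/cquot_piE; exact: (congr1 (fun g => g false) E).
Qed.

End Meet.

Section Ultrafilters.

(** Pigeonhole: otherwise [U] would contain the finitely many complements, hence their intersection,
    which is disjoint from the set assumed to be in [U]. *)
Lemma ultra_finite (I : Type) (T : choiceType) (U : set_system I) (B : set T)
    (R : I -> T -> Prop) : UltraFilter U -> finite_set B ->
  U [set i | exists2 t, B t & R i t] -> exists2 t, B t & U [set i | R i t].
Proof.
move=> UU /finite_fsetP[X ->] UR; apply: contrapT => H.
have UN : U (\bigcap_(t in [set` X]) [set i | ~ R i t]); last first.
  by have [i [[t Bt Rit] /(_ t Bt)]] := filter_ex (filterI UR UN).
apply: filter_bigI => t tX.
have [Ut|//] := in_ultra_setVsetC [set i | R i t] UU.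
by case: H; exists t.
Qed.

Lemma filter_choice (I T : Type) (U : set_system I) (R : I -> T -> Prop) :
  ProperFilter U -> U [set i | exists t, R i t] ->
  exists f : I -> T, U [set i | R i (f i)].
Proof.
move=> UU UR; have [_ [t0 _]] := filter_ex UR.
have [f fP] : {f : I -> T & forall i, (exists t, R i t) -> R i (f i)}.
  apply: (@choice I T (fun i t => (exists t', R i t') -> R i t)) => i.
  by have [[t Rt]|nR] := pselect (exists t, R i t); [exists t | exists t0 => /nR].
by exists f; apply: filterS UR => i; exact: fP.
Qed.

End Ultrafilters.

Section FreeProV.
Variables (V : semigroupType -> Prop) (A : finType).
Hypothesis hV : pseudovariety V.
Hypothesis hLSl : forall S : semigroupType, LSl S -> V S.

Notation F := (free_proV V A).
Implicit Types (x y e : F) (c d : Vcongruence V A) (u v w z : word A).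

(** The inclusion of [LSl] in [V] enters here: prefix, suffix and factors of length [n] are read off
    a single coordinate of a pseudoword. *)
Definition factor_level n : Vcongruence V A :=
  exist _ (factor_congruence A n) (hLSl (factor_congruence_LSl A n)).

Lemma finer_factor_level c n u v : finer c (factor_level n) -> sval c u v ->
  factor_sig n u = factor_sig n v.
Proof. by move=> cn /cn; move/factor_congruenceE. Qed.

Lemma finer_refl c : finer c c. Proof. by []. Qed.

Lemma finer_meet c d : exists b, finer b c /\ finer b d.
Proof.
exists (exist _ (meet_congruence (sval c) (sval d))
  (meet_congruence_in hV (svalP c) (svalP d))).
by split=> u v /andP[].
Qed.

Lemma Vcongruence_ultrafilter : exists U : set_system (Vcongruence V A),
  UltraFilter U /\ forall d, U [set c | finer c d].
Proof.
pose D := filter_from [set: Vcongruence V A] (fun d => [set c | finer c d]).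
have DF : ProperFilter D.
  apply: filter_from_proper; last by move=> d _; exists d; exact: finer_refl.
  apply: filter_from_filter; first by exists (factor_level 0).
  move=> c d _ _; have [b [bc bd]] := finer_meet c d; exists b => // b' b'b.
  by split=> u v /b'b; [exact: bc | exact: bd].
have [U [UU DU]] := ultraFilterLemma DF.
by exists U; split=> // d; apply: DU; exists d.
Qed.

Definition approx c x w := to_quot x c = \pi_(cquot (sval c)) w.

Lemma approx_ex c x : exists w, approx c x w.
Proof. by exists (repr (to_quot x c : cquot (sval c))); rewrite /approx reprK. Qed.

Lemma approx_word c w : approx c (of_word V w) w. Proof. by []. Qed.

Lemma approxM c x y u v : approx c x u -> approx c y v -> approx c (x * y) (u * v).
Proof.
move=> xu yv; rewrite /approx.
have -> : to_quot (x * y) c = to_quot x c * to_quot y c by [].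
by rewrite xu yv; exact: cquot_piM.
Qed.

Lemma approx_finer c d x w : finer c d -> approx c x w -> approx d x w.
Proof.
by move=> cd xw; rewrite /approx -(to_quotP x cd) xw transition_pi.
Qed.

Lemma approxE c x u v : approx c x u -> approx c x v <-> sval c u v.
Proof.
move=> xu; rewrite /approx xu; split=> [/cquot_piE//|uv].
exact/cquot_piE.
Qed.

Lemma approx_sig n c x u v : finer c (factor_level n) ->
  approx c x u -> approx c x v -> factor_sig n u = factor_sig n v.
Proof. by move=> cn xu /(approxE _ xu); exact: finer_factor_level. Qed.

(** The exponent is [m.+1], since the free semigroup has no unit. *)
Definition word_pow w m : word A := iter m (mul w) w.

Lemma val_word_pow w m : val (word_pow w m) = flatten (nseq m.+1 (val w)).
Proof.
elim: m => [|m IH]; first by rewrite /= cats0.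
by rewrite [word_pow _ _]/= val_mul IH.
Qed.

Lemma approx_pow c e w m : is_idempotent e -> approx c e w -> approx c e (word_pow w m).
Proof.
by move=> ee ew; elim: m => // m IH; rewrite -ee; exact: approxM.
Qed.

Section Limits.
Variable U : set_system (Vcongruence V A).
Hypothesis UU : UltraFilter U.
Hypothesis Ufiner : forall d, U [set c | finer c d].

Definition tends (y : Vcongruence V A -> F) x :=
  forall d, U [set c | to_quot (y c) d = to_quot x d].

(** Compactness: every coordinate takes finitely many values, so [U] selects one; two selected
    values are compatible because a single [c] realizes both. *)
Lemma tends_ex (y : Vcongruence V A -> F) : exists x, tends y x.
Proof.
have H d : exists p : Vquot d, U [set c | to_quot (y c) d = p].
  have [||p _ Up] := @ultra_finite _ _ U [set: Vquot d]
    (fun c p => to_quot (y c) d = p) UU; last by exists p.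
  - exact: pseudovariety_finite hV _ (svalP d).
  - by apply: filterE => c /=; exists (to_quot (y c) d).
pose l d := projT1 (cid (H d)).
have lP d : U [set c | to_quot (y c) d = l d] := projT2 (cid (H d)).
have lc : compatible (l : prod_topology _).
  move=> d b db; have [c [<- <-]] := filter_ex (filterI (lP d) (lP b)).
  exact: to_quotP.
by exists (exist (fun t => t \in @compatible V A) _ (mem_set lc)).
Qed.

Lemma tendsM (y y' : Vcongruence V A -> F) x x' : tends y x -> tends y' x' ->
  tends (fun c => y c * y' c) (x * x').
Proof.
move=> yx yx' d; apply: filterS (filterI (yx d) (yx' d)) => c [/= E E'].
have M (a b : F) : to_quot (a * b) d = to_quot a d * to_quot b d by [].
by rewrite !M E E'.
Qed.

Lemma tends_cst x : tends (fun=> x) x.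
Proof. by move=> d; exact: filterE. Qed.

Lemma tends_unique (y : Vcongruence V A -> F) x x' : tends y x -> tends y x' -> x = x'.
Proof.
move=> yx yx'; apply: to_quot_inj => d.
by have [c [/= <- <-]] := filter_ex (filterI (yx d) (yx' d)).
Qed.

(** Agreement at level [c] descends to every coarser level [d], and [U]-almost every [c] is finer
    than [d]. *)
Lemma tends_diag (y : Vcongruence V A -> F) x :
  U [set c | to_quot (y c) c = to_quot x c] -> tends y x.
Proof.
move=> H d; apply: filterS (filterI H (Ufiner d)) => c [/= E cd].
by rewrite -(to_quotP (y c) cd) -(to_quotP x cd) E.
Qed.

Lemma limit_factor x z :
  U [set c | exists a, exists b, approx c x (a * z * b)] ->
  exists a b, x = a * of_word V z * b.
Proof.
move=> H; have [|f Uf] := @filter_choice _ (word A * word A) U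
    (fun c ab => approx c x (ab.1 * z * ab.2)).
  by apply: filterS H => c [a [b abx]]; exists (a, b).
have [a fa] := tends_ex (fun c => of_word V (f c).1).
have [b fb] := tends_ex (fun c => of_word V (f c).2).
exists a, b; apply: (tends_unique _ (tendsM (tendsM fa (tends_cst _)) fb)).
apply: tends_diag; apply: filterS Uf => c /= ->.
by rewrite -!of_wordM.
Qed.

Lemma limit_right x y :
  U [set c | exists w, exists2 t, approx c x w & approx c y (w * t)] ->
  exists t, y = x * t.
Proof.
move=> H; have [|f Uf] := @filter_choice _ (word A) U
    (fun c t => to_quot y c = to_quot (x * of_word V t) c).
  apply: filterS H => c [w [t xw yt]]; exists t.
  by rewrite [LHS]yt; apply/esym/approxM.
have [t ft] := tends_ex (fun c => of_word V (f c)).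
exists t; apply: (tends_unique _ (tendsM (tends_cst x) ft)).
by apply: tends_diag; apply: filterS Uf => c /= ->.
Qed.

Lemma limit_left x y :
  U [set c | exists w, exists2 t, approx c x w & approx c y (t * w)] ->
  exists t, y = t * x.
Proof.
move=> H; have [|f Uf] := @filter_choice _ (word A) U
    (fun c t => to_quot y c = to_quot (of_word V t * x) c).
  apply: filterS H => c [w [t xw yt]]; exists t.
  by rewrite [LHS]yt; apply/esym/approxM.
have [t ft] := tends_ex (fun c => of_word V (f c)).
exists t; apply: (tends_unique _ (tendsM ft (tends_cst x))).
by apply: tends_diag; apply: filterS Uf => c /= ->.
Qed.

End Limits.

End FreeProV.

Arguments finer_refl {V A} c [u v] _.

(** * The topology of the limit and the omega power *)

Section Topology.
Variables (V : semigroupType -> Prop) (A : finType).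
Hypothesis hV : pseudovariety V.
Hypothesis hLSl : forall S : semigroupType, LSl S -> V S.

Notation F := (free_proV V A).
Implicit Types (x y e : F) (c d : Vcongruence V A) (u v w z : word A).

Definition cylinder x d : set F := [set y | to_quot y d = to_quot x d].

Lemma cylinder_nbhs x d : nbhs x (cylinder x d).
Proof.
pose P := prod_topology (fun c => discrete_topology (Vquot (A := A) (V := V) c)).
have dc : continuous (fun f : P => f d).
  move=> f; have : f --> f by exact: cvg_id.
  by move=> /cvg_sup/(_ d) H N /(initial_continuous (f := fun f : P => f d)) /H.
have vc : continuous (fun y : F => set_val y : P) by exact: initial_continuous.
have : nbhs (set_val x d : discrete_topology (Vquot d)) [set to_quot x d].
  by rewrite nbhs_principalE; apply/principal_filterP.
by move=> /dc /vc.
Qed.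

(** By common refinements, the images of the cylinders of [x] in the product form a filter base;
    convergence of this filter to [x] is checked one coordinate at a time. *)
Lemma cylinder_basis x (N : set F) : nbhs x N -> exists d, cylinder x d `<=` N.
Proof.
pose P := prod_topology (fun c => discrete_topology (Vquot (A := A) (V := V) c)).
pose G : set_system P := filter_from setT (fun d => [set set_val y | y in cylinder x d]).
have GF : Filter G.
  apply: filter_from_filter; first by exists (factor_level A hLSl 0).
  move=> c d _ _; have [b [bc bd]] := finer_meet hV c d; exists b => // _ [y yx <-].
  by split; exists y => //; [rewrite /cylinder/= -(to_quotP y bc) -(to_quotP x bc) yx
    | rewrite /cylinder/= -(to_quotP y bd) -(to_quotP x bd) yx].
have Gx : G --> (set_val x : P).
  apply/cvg_sup => d M [_ [[O oO <-] Ox OM]].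
  by exists d => // _ [y yx <-]; apply: OM; rewrite /= [set_val y d]yx.
case=> _ [[W oW <-] Wx WN].
have /Gx[d _ dW] : nbhs (set_val x : P) W by apply: open_nbhs_nbhs.
by exists d => y yx; apply: WN; apply: dW; exists y.
Qed.

(** The right-hand condition defines a closed subsemigroup containing [w]; conversely, it places [x]
    in the closure of the powers of [w]. *)
Lemma closed_subsemigroup_wordP w x :
  closed_subsemigroup (of_word V w) x <-> forall c, exists m, approx c x (word_pow w m).
Proof.
split=> [wx|wx].
  apply: (wx [set y : F | forall c, exists m, approx c y (word_pow w m)]).
  split; last by move=> _ -> c; exists 0; exact: approx_word.
  split=> [y By c|y y' By By' c].
    have [y' [/(_ c)[m wm] yy']] := By _ (cylinder_nbhs y c).
    by exists m; rewrite /approx -[LHS]yy'.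
  have [m ym] := By c; have [m' ym'] := By' c; exists (m + m').+1.
  have -> : word_pow w (m + m').+1 = word_pow w m * word_pow w m'.
    apply: val_inj; rewrite val_mul !val_word_pow -flatten_nseqD.
    by rewrite addSn addnS.
  exact: approxM.
move=> B [[clB BM] wB]; apply: clB => N /cylinder_basis[d dN].
have [m wm] := wx d; exists (of_word V (word_pow w m)); split.
  have Bw : B (of_word V w) by exact: wB.
  by elim: m {wm} => //= m IH; rewrite of_wordM; exact: BM.
by apply: dN; rewrite /cylinder/= [RHS]wm.
Qed.

(* The default value of [xget] in [omega] also lies in this set, so the existence
   of an idempotent is not an issue. *)
Lemma omega_closed_subsemigroup w :
  closed_subsemigroup (of_word V w) (omega (of_word V w)).
Proof.
rewrite /omega; case: xgetP => [f _ []//|_].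
by apply/closed_subsemigroup_wordP => c; exists 0; exact: approx_word.
Qed.

(** At level [c], both [e] and the omega power are approximated by powers of [w], of exponents
    [m.+1] and [n.+1]. Being idempotent, each is also approximated by powers of these, and both
    reach the exponent [m.+1 * n.+1]. *)
Lemma omegaP w e : is_idempotent e ->
  e = omega (of_word V w) <-> forall c, exists m, approx c e (word_pow w m).
Proof.
move=> ee; split=> [->|we].
  by apply: (closed_subsemigroup_wordP _ _).1; exact: omega_closed_subsemigroup.
have /closed_subsemigroup_wordP we' := we.
(* [e] itself shows that [xget] chooses from a nonempty set, so the omega power is idempotent. *)
have [wf ff] : [set f | closed_subsemigroup (of_word V w) f /\ is_idempotent f]
    (omega (of_word V w)) by apply: xgetPex; exists e.
apply: to_quot_inj => c.
have [m em] := we c; have [n fn] := (closed_subsemigroup_wordP _ _).1 wf c.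
have E : word_pow (word_pow w m) n = word_pow (word_pow w n) m.
  by apply: val_inj; rewrite !val_word_pow !flatten_nseqM mulnC.
by rewrite [LHS](approx_pow n ee em) E; apply/esym/approx_pow.
Qed.

End Topology.

(** * Green's relations *)

Section Green.
Variable S : semigroupType.
Implicit Types x y e s t : S.

Lemma twosided_ideal_mul x s t : twosided_ideal x (s * x * t).
Proof. by right; exists s, t. Qed.

Lemma twosided_ideal_sub x y : twosided_ideal x y -> twosided_ideal y `<=` twosided_ideal x.
Proof.
have R z t : twosided_ideal x z -> twosided_ideal x (z * t).
  case=> [[[->|[a _ <-]]|[->|[a _ <-]]]|[a [b ->]]].
  - by left; left; right; exists t.
  - by left; left; right; exists (a * t) => //; rewrite mulgA.
  - by left; left; right; exists t.
  - by right; exists a, t.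
  - by right; exists a, (b * t); rewrite !mulgA.
have L z t : twosided_ideal x z -> twosided_ideal x (t * z).
  case=> [[[->|[a _ <-]]|[->|[a _ <-]]]|[a [b ->]]].
  - by left; right; right; exists t.
  - by right; exists t, a; rewrite mulgA.
  - by left; right; right; exists t.
  - by left; right; right; exists (t * a) => //; rewrite mulgA.
  - by right; exists (t * a), b; rewrite !mulgA.
move=> xy z [[[->//|[a _ <-]]|[->//|[a _ <-]]]|[a [b ->]]].
- exact: R.
- exact: L.
- exact/R/L.
Qed.

Lemma twosided_ideal_refl x : twosided_ideal x x.
Proof. by left; left; left. Qed.

Lemma greenJP x y : greenJ x y <-> twosided_ideal x y /\ twosided_ideal y x.
Proof.
split=> [xy|[xy yx]]; last by apply/seteqP; split; exact: twosided_ideal_sub.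
by split; [rewrite [twosided_ideal x]xy | rewrite -[twosided_ideal y]xy];
  exact: twosided_ideal_refl.
Qed.

Lemma idempotent_twosided_ideal e x : is_idempotent e ->
  twosided_ideal e x -> exists a b, x = a * e * b.
Proof.
move=> ee [[[->|[a _ <-]]|[->|[a _ <-]]]|//].
- by exists e, e; rewrite ee ee.
- by exists e, a; rewrite ee.
- by exists e, e; rewrite ee ee.
- by exists a, e; rewrite -mulgA ee.
Qed.

Lemma twosided_ideal_idempotent e x : is_idempotent e ->
  twosided_ideal x e -> exists a b, e = a * x * b.
Proof.
move=> ee [[[ex|[a _ ex]]|[ex|[a _ ex]]]|//].
- by exists x, x; rewrite -ex ee ee.
- by exists e, a; rewrite -mulgA ex ee.
- by exists x, x; rewrite -ex ee ee.
- by exists a, e; rewrite ex ee.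
Qed.

Lemma greenR_right_ideal x y : greenR x y -> y = x \/ exists t, y = x * t.
Proof.
move=> xy; have : right_ideal x y by rewrite [right_ideal x]xy; left.
by case=> [->|[t _ <-]]; [left | right; exists t].
Qed.

Lemma greenL_left_ideal x y : greenL x y -> y = x \/ exists t, y = t * x.
Proof.
move=> xy; have : left_ideal x y by rewrite [left_ideal x]xy; left.
by case=> [->|[t _ <-]]; [left | right; exists t].
Qed.

Lemma greenR_mul x y s t : y = x * s -> x = y * t -> greenR x y.
Proof.
move=> yx xy; apply/seteqP; split=> z [->|[a _ <-]].
- by right; exists t.
- by right; exists (t * a) => //; rewrite mulgA -xy.
- by right; exists s.
- by right; exists (s * a) => //; rewrite mulgA -yx.
Qed.

Lemma greenL_mul x y s t : y = s * x -> x = t * y -> greenL x y.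
Proof.
move=> yx xy; apply/seteqP; split=> z [->|[a _ <-]].
- by right; exists t.
- by right; exists (a * t) => //; rewrite -mulgA -xy.
- by right; exists s.
- by right; exists (a * s) => //; rewrite -mulgA -yx.
Qed.

Lemma greenR_sub_greenJ x y : greenR x y -> greenJ x y.
Proof.
move=> xy; apply/greenJP; split; left; left.
- by rewrite [right_ideal x]xy; left.
- by rewrite -[right_ideal y]xy; left.
Qed.

Lemma greenL_sub_greenJ x y : greenL x y -> greenJ x y.
Proof.
move=> xy; apply/greenJP; split; left; right.
- by rewrite [left_ideal x]xy; left.
- by rewrite -[left_ideal y]xy; left.
Qed.

End Green.

(** * Pseudowords with boundedly many factors of each length *)

Section Factors.
Variables (V : semigroupType -> Prop) (A : finType).
Hypothesis hV : pseudovariety V.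
Hypothesis hLSl : forall S : semigroupType, LSl S -> V S.

Notation F := (free_proV V A).
Notation level := (factor_level A hLSl).
Implicit Types (x y e : F) (c d : Vcongruence V A) (u v w : word A).

Definition sig x n := factor_sig n (repr (to_quot x (level n) : cquot (sval (level n)))).

Lemma sigE c x w n : finer c (level n) -> approx c x w -> sig x n = factor_sig n w.
Proof.
move=> cn xw; rewrite /sig; apply: (approx_sig (finer_refl (level n)) (x := x)).
  by rewrite /approx reprK.
exact: approx_finer cn xw.
Qed.

Lemma mem_sig c x w n (z : n.-tuple A) : finer c (level n) -> approx c x w ->
  (z \in (sig x n).2) = infix z (val w).
Proof. by move=> cn xw; rewrite (sigE cn xw) inE. Qed.

Lemma sig_prefixM x y n : size (sig x n).1.1 = n -> (sig (x * y) n).1.1 = (sig x n).1.1.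
Proof.
have [u xu] := approx_ex (level n) x; have [v yv] := approx_ex (level n) y.
rewrite (sigE (finer_refl _) xu) (sigE (finer_refl _) (approxM xu yv))/=.
rewrite size_take_min => un; apply: takel_cat.
by rewrite -un geq_minr.
Qed.

Lemma sig_suffixM x y n : size (sig y n).1.2 = n -> (sig (x * y) n).1.2 = (sig y n).1.2.
Proof.
have [u xu] := approx_ex (level n) x; have [v yv] := approx_ex (level n) y.
rewrite (sigE (finer_refl _) yv) (sigE (finer_refl _) (approxM xu yv))/=.
rewrite size_rev size_take_min size_rev => un; apply: last_takel_cat.
by rewrite -un geq_minr.
Qed.

Lemma sig_word w n : size (val w) = n -> (sig (of_word V w) n).1 = (val w, val w).
Proof.
move=> <-; rewrite (sigE (finer_refl _) (approx_word _ _))/= take_size.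
by rewrite /last_take -size_rev take_size revK.
Qed.

Section Idempotent.
Variable e : F.
Hypothesis ee : is_idempotent e.

Lemma factorization n (z : n.-tuple A) w : val z = val w -> z \in (sig e n).2 ->
  exists a b, e = a * of_word V w * b.
Proof.
move=> zw ze; have [U [UU Uf]] := Vcongruence_ultrafilter A hV hLSl.
apply: (limit_factor hV UU Uf); apply: filterS (Uf (level n)) => c /= cn.
have [u eu] := approx_ex c e.
move: ze; rewrite (mem_sig _ cn eu) => /infixP[s [s' E]].
have us : val u ++ s != [::] by case: u {eu E} => -[].
have su : s' ++ val u != [::] by case: u {eu E us} => -[]//= a l _; case: s'.
pose a : word A := Sub (val u ++ s) us; pose b : word A := Sub (s' ++ val u) su.
(* [word_pow u 2] is [u * u * u]; the occurrence of [z] is taken in the middle copy, so that both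
   cofactors are nonempty. *)
exists a, b; suff <- : word_pow u 2 = a * w * b by exact: approx_pow.
apply: val_inj; rewrite val_word_pow/= cats0 {2}E [tval z]zw.
by rewrite -!catA.
Qed.

Lemma prefix_idempotent n (z : n.+1.-tuple A) : z \in (sig e n.+1).2 ->
  exists f, [/\ is_idempotent f, Jclass e f & (sig f n.+1).1.1 = z].
Proof.
have z0 : val z != [::] by rewrite -size_eq0 size_tuple.
pose w : word A := Sub (val z) z0; have wn : size (val w) = n.+1 by exact: size_tuple.
move=> /(@factorization _ _ w erefl)[a [b E]]; exists (of_word V w * b * e * a); split.
- rewrite /is_idempotent.
  transitivity (of_word V w * b * e * (a * of_word V w * b) * e * a).
    by rewrite !mulgA.
  by rewrite -E -(mulgA _ e e) ee -(mulgA _ e e) ee.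
- apply/greenJP; split.
    exact: twosided_ideal_mul.
  (* This is [e = e * e * e] with both outer factors replaced by the factorization [E]. *)
  have E' : e = a * (of_word V w * b * e * a) * (of_word V w * b).
    transitivity ((a * of_word V w * b) * e * (a * of_word V w * b)); last by rewrite !mulgA.
    by rewrite -E ee ee.
  by rewrite [X in twosided_ideal _ X]E'; exact: twosided_ideal_mul.
- by rewrite -!mulgA sig_prefixM sig_word.
Qed.

Lemma suffix_idempotent n (z : n.+1.-tuple A) : z \in (sig e n.+1).2 ->
  exists f, [/\ is_idempotent f, Jclass e f & (sig f n.+1).1.2 = z].
Proof.
have z0 : val z != [::] by rewrite -size_eq0 size_tuple.
pose w : word A := Sub (val z) z0; have wn : size (val w) = n.+1 by exact: size_tuple.
move=> /(@factorization _ _ w erefl)[a [b E]]; exists (b * e * a * of_word V w); split.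
- rewrite /is_idempotent.
  transitivity (b * e * (a * of_word V w * b) * e * a * of_word V w).
    by rewrite !mulgA.
  by rewrite -E -(mulgA _ e e) ee -(mulgA _ e e) ee.
- apply/greenJP; split.
    by rewrite -mulgA; exact: twosided_ideal_mul.
  have E' : e = a * of_word V w * (b * e * a * of_word V w) * b.
    transitivity ((a * of_word V w * b) * e * (a * of_word V w * b)); last by rewrite !mulgA.
    by rewrite -E ee ee.
  by rewrite [X in twosided_ideal _ X]E'; exact: twosided_ideal_mul.
- by rewrite sig_suffixM sig_word.
Qed.

(** If the number of factors increased strictly with the length, there would be at least [n] of
    length [n.+1], which exceeds [r] for [n = r.+1]. *)
Lemma bounded_complexity r : (forall n, #|(sig e n.+1).2| <= r) ->
  exists n, #|(sig e n.+2).2| <= #|(sig e n.+1).2|.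
Proof.
move=> Cr; apply: contrapT => H.
have C n : n <= #|(sig e n.+1).2|.
  elim: n => // n IH; apply: leq_ltn_trans IH _; rewrite ltnNge.
  by apply/negP => le; apply: H; exists n.
by have := leq_trans (C r.+1) (Cr r.+1); rewrite ltnn.
Qed.

(* Restriction to the first n letters maps the factors of length n + 1 onto those
   of length n, because e = e e; by the cardinality assumption it is injective. *)
Lemma right_deterministic n : #|(sig e n.+1).2| <= #|(sig e n).2| ->
  forall z z' : n.+1.-tuple A, z \in (sig e n.+1).2 -> z' \in (sig e n.+1).2 ->
    take n z = take n z' -> z = z'.
Proof.
move=> Cn.
have sz (z : n.+1.-tuple A) : size (take n z) == n by rewrite size_takel ?size_tuple.
pose f z := Tuple (sz z).
have sub : (sig e n).2 \subset [set f z | z in (sig e n.+1).2]%SET.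
  apply/fintype.subsetP => z; have [c [cn cn1]] := finer_meet hV (level n) (level n.+1).
  have [u eu] := approx_ex c e; rewrite (mem_sig _ cn eu) => /infixP[s [s' E]].
  have [a [l ul]] : exists a l, s' ++ val u = a :: l.
    case: s' E => [|a l] E; last by exists a, (l ++ val u).
    by case: u {eu E} => -[|a l]//= _; exists a, l.
  have zs : size (rcons z a) == n.+1 by rewrite size_rcons size_tuple.
  apply/imsetP; exists (Tuple zs).
    rewrite (mem_sig _ cn1 (approx_pow 1 ee eu)) val_word_pow/= cats0 {1}E.
    by rewrite -!catA ul -cat_rcons infix_infix.
  by apply: val_inj; rewrite /= -cats1 take_size_cat ?size_tuple.
have /imset_injP finj : #|[set f z | z in (sig e n.+1).2]%SET| == #|(sig e n.+1).2|.
  by rewrite eqn_leq leq_imset_card (leq_trans Cn)// subset_leq_card.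
by move=> z z' ze ze' zz'; apply: finj => //; apply: val_inj.
Qed.

Lemma bounded_complexity_omega r : (forall n, #|(sig e n.+1).2| <= r) ->
  exists u, e = omega (of_word V u).
Proof.
move=> /bounded_complexity[N] /right_deterministic; set n := N.+1 => det.
have [w0 ew0] := approx_ex (level n.+1) e.
have w0_gt0 : 0 < size (val w0) by case: w0 {ew0} => -[].
have [a0 _] : exists a : A, True by case: w0 {ew0 w0_gt0} => -[|a]//; exists a.
(* Every power of [w0] approximates [e] at this level, and these powers are prefixes of [p]; hence
   all segments of [p] of length [n.+1] are factors of [e]. *)
pose p := periodic_seq a0 (val w0).
have pow0 m : approx (level n.+1) e (word_pow w0 m) /\
    val (word_pow w0 m) = segment p 0 (m.+1 * size (val w0)).
  by rewrite segment_periodic_seq -val_word_pow; split=> //; exact: approx_pow.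
have le0 m : m <= m.+1 * size (val w0) by rewrite (leq_trans (leqnSn m))// leq_pmulr.
(* Windows of length [n.+1] of [w] and of [p] are factors of [e], so by [det] they coincide once
   their first [n] letters do; as [w] starts like [p], it follows [p] to its end. *)
have wp c w : finer c (level n.+1) -> approx c e w -> val w = segment p 0 (size (val w)).
  move=> cn ew; have sigw := sigE cn ew.
  apply: (@segment_prefix _ _ n).
    have [app E] := pow0 n.+1.
    have : take n.+1 (val w) = segment p 0 n.+1.
      have -> : take n.+1 (val w) = (sig e n.+1).1.1 by rewrite sigw.
      by rewrite (sigE (finer_refl _) app) -(take_segment p 0 (le0 n.+1)) -E.
    move=> /(congr1 (take n)); rewrite take_segment// => <-.
    by rewrite take_takel.
  move=> z j /eqP zn zw zj.
  have segn : size (segment p j n.+1) == n.+1 by rewrite size_segment.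
  suff : Tuple zn = Tuple segn by move=> /(congr1 val).
  apply: det.
  - by rewrite (mem_sig _ cn ew).
  - have [app E] := pow0 (j + n.+1).
    by rewrite (mem_sig _ (finer_refl _) app) E segment_infix.
  - exact: etrans zj (esym (take_segment p j (leqnSn n))).
(* The powers of [w] approximate [e] as well, so they too are prefixes of [p]. *)
have period_size c w : finer c (level n.+1) -> approx c e w -> period p (size (val w)).
  move=> cn ew; apply: flatten_nseq_period => -[//|m].
  rewrite -val_word_pow (wp c)//; last exact: approx_pow.
  by rewrite val_word_pow size_flatten_nseq.
(* The least period divides the length of every such approximating word, so the prefix of [p] of
   this length serves all levels. *)
have [k k_gt0 [pk kmin]] := minimal_period w0_gt0 (period_size _ _ (finer_refl _) ew0).
have uk : segment p 0 k != [::] by rewrite -size_eq0 size_segment -lt0n.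
pose u : word A := Sub (segment p 0 k) uk.
exists u; apply/(omegaP hV hLSl u ee) => c.
have [d [dc dn]] := finer_meet hV c (level n.+1).
have [w ew] := approx_ex d e; have /dvdnP[q wq] := kmin _ (period_size _ _ dn ew).
exists q.-1; suff <- : w = word_pow u q.-1 by exact: approx_finer ew.
have q_gt0 : 0 < q.
  case: q wq => // w00; suff : 0 < size (val w) by rewrite w00.
  by case: (w) => -[].
apply: val_inj; rewrite val_word_pow prednK// (wp d w dn ew) wq.
exact: segment_pow.
Qed.

End Idempotent.
End Factors.

(** * The J-class of a power *)

Section PowerJclass.
Variables (V : semigroupType -> Prop) (A : finType).
Hypothesis hV : pseudovariety V.
Hypothesis hLSl : forall S : semigroupType, LSl S -> V S.
Variables (a0 : A) (e : free_proV V A) (u : word A).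
Hypothesis ee : is_idempotent e.
Hypothesis eu : forall c, exists m, approx c e (word_pow u m).

Notation F := (free_proV V A).
Notation level := (factor_level A hLSl).
Notation k := (size (val u)).
Implicit Types (x y : F) (c d : Vcongruence V A) (v w : word A).

Lemma power_length_gt0 : 0 < k.
Proof. by case: (u) => -[]. Qed.

Let p := periodic_seq a0 (val u).

Lemma approx_large_power c m :
  exists w l, [/\ approx c e w, m <= l & val w = segment p 0 (l * k)].
Proof.
have [n en] := eu c; exists (word_pow (word_pow u n) m), (m.+1 * n.+1)%N; split.
- exact: approx_pow.
- by rewrite (leq_trans (leqnSn m))// leq_pmulr.
- by rewrite val_word_pow val_word_pow segment_periodic_seq flatten_nseqM.
Qed.

(** Windows of length [k.+1] of [w] are factors of [e], hence segments of [p]. Since [k] is a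
    period, the last letter of such a segment repeats the first, so its first [k] letters determine
    it. *)
Lemma approx_power_segment c w : finer c (level k.+1) -> approx c e w ->
  val w = segment p 0 (size (val w)).
Proof.
move=> ck ew; have k_gt0 := power_length_gt0.
have [v [l [ev kl vl]]] := approx_large_power c k.+1.
have pk : period p k := periodic_seq_period _ _.
apply: (@segment_prefix _ _ k).
  have : take k.+1 (val w) = segment p 0 k.+1.
    have -> : take k.+1 (val w) = (sig hLSl e k.+1).1.1 by rewrite (sigE ck ew).
    rewrite (sigE ck ev) -(@take_segment _ p 0 (l * k)) -?vl//.
    by rewrite (leq_trans kl)// leq_pmulr.
  by move=> /(congr1 (take k)); rewrite take_segment// => <-; rewrite take_takel.
move=> z j zk; have zk' := introT eqP zk.
have -> : infix z (val w) = (Tuple zk' \in (sig hLSl e k.+1).2) by rewrite (mem_sig _ ck ew).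
rewrite (mem_sig _ ck ev) vl => /infix_segment[i]; rewrite size_tuple => /= ->.
rewrite take_segment// => ij; rewrite -[k.+1]addn1 !segment_cat ij; congr (_ ++ _).
rewrite /segment /mkseq [LHS]/= [RHS]/= !addn0 !pk.
by have := congr1 (fun s => nth a0 s 0) ij; rewrite !nth_mkseq// !addn0 => ->.
Qed.

(* At level c, x is approximated by arbitrarily long words of one residue class of
   lengths, read from a fixed position of the periodic word p. *)
Definition has_type x (ij : 'I_k * 'I_k) c := forall m, exists w,
  [/\ approx c x w, m <= size (val w), (size (val w) = ij.2 %[mod k])%N &
      val w = segment p ij.1 (size (val w))].

(** Write [x = a * e * b] and [e = s * x * t]. Approximating the first [e] by a long power of [u]
    gives a word [w] for [x]; then [s' * w * t'] approximates [e], so [w] is a segment of [p]. Its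
    start, and its length modulo [k], do not depend on the power chosen. *)
Lemma has_type_ex x c : Jclass e x -> finer c (level k.+1) -> exists ij, has_type x ij c.
Proof.
move=> /greenJP[ex xe] ck; have k_gt0 := power_length_gt0.
have [a [b xab]] := idempotent_twosided_ideal ee ex.
have [s [t est]] := twosided_ideal_idempotent ee xe.
have [a' aa'] := approx_ex c a; have [b' bb'] := approx_ex c b.
have [s' ss'] := approx_ex c s; have [t' tt'] := approx_ex c t.
exists (Ordinal (ltn_pmod (size (val s')) k_gt0),
        Ordinal (ltn_pmod (size (val a') + size (val b')) k_gt0)) => m.
have [v [l [ev ml vl]]] := approx_large_power c m.
have xw : approx c x (a' * v * b') by rewrite xab; do 2!apply: approxM => //.
have ew : approx c e (s' * (a' * v * b') * t').
  by rewrite est; do 2!apply: approxM => //.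
pose w : word A := a' * v * b'; rewrite -/w in xw ew.
have wE : size (val w) = size (val a') + size (val b') + l * k.
  by rewrite /w !val_mul !size_cat vl size_segment addnAC.
clearbody w; exists w; split=> //.
- rewrite wE (leq_trans ml)// (leq_trans _ (leq_addl _ _))// leq_pmulr//.
- by rewrite /= modn_mod wE addnC modnMDl.
- have := approx_power_segment ck ew.
  have -> : val (s' * w * t') = val s' ++ val w ++ val t' by rewrite catA.
  rewrite !size_cat !segment_cat add0n => /eqP.
  rewrite eqseq_cat ?size_segment// eqseq_cat ?size_segment// => /and3P[_ /eqP E _].
  rewrite {1}E; apply: segment_period (periodic_seq_period _ _) _.
  by rewrite modn_mod.
Qed.

(** With a common start, a word [w] for [x] is a prefix of a longer word [w'] for [y]. The lengths
    differ by a multiple of the period [k], so [w] is also a suffix of [w']. *)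
Lemma has_type_mul U x y ij : UltraFilter U -> (forall d, U [set c | finer c d]) ->
  U (has_type x ij) -> U (has_type y ij) ->
  (exists t, y = x * t) /\ (exists t, y = t * x).
Proof.
move=> UU Uf Ux Uy; have pk : period p k := periodic_seq_period _ _.
have H c : has_type x ij c -> has_type y ij c -> exists w t t',
    [/\ approx c x w, approx c y (w * t) & w * t = t' * w].
  (* Asking for [w'] strictly longer than [w] keeps the cofactors nonempty. *)
  move=> /(_ 0)[w [xw _ wk wp]] /(_ (size (val w)).+1)[w' [yw' lt wk' wp']].
  pose l := size (val w') - size (val w).
  have wl : size (val w') = size (val w) + l by rewrite subnKC// ltnW.
  have l_gt0 : 0 < l by rewrite subn_gt0.
  have t0 i : segment p i l != [::] by rewrite -size_eq0 size_segment -lt0n.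
  pose seg i : word A := Sub (segment p i l) (t0 i).
  exists w, (seg (ij.1 + size (val w))), (seg ij.1).
  have E : w' = w * seg (ij.1 + size (val w)).
    by apply: val_inj; rewrite val_mul [LHS]wp' wl segment_cat -wp.
  rewrite -E; split=> //; apply: val_inj.
  rewrite val_mul [LHS]wp' wl addnC segment_cat; congr (_ ++ _).
  rewrite [RHS]wp; apply: segment_period => //.
  have /eqP : (size (val w) + l = size (val w) + 0 %[mod k])%N by rewrite -wl addn0 wk'.
  by rewrite eqn_modDl => /eqP l0; rewrite -modnDmr l0 mod0n addn0.
split.
- apply: (limit_right hV UU Uf); apply: filterS (filterI Ux Uy) => c [xc yc].
  by have [w [t [t' [xw yw _]]]] := H c xc yc; exists w, t.
- apply: (limit_left hV UU Uf); apply: filterS (filterI Ux Uy) => c [xc yc].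
  by have [w [t [t' [xw yw E]]]] := H c xc yc; exists w, t' => //; rewrite -E.
Qed.

(** There are finitely many types, so [U] selects one for each [x] in the J-class. When the types of
    [x] and [y] agree, [has_type_mul] applies in both directions. *)
Lemma finite_index_greenH : exists (T : finType) (f : F -> T),
  forall x y, Jclass e x -> Jclass e y -> f x = f y -> greenH x y.
Proof.
have [U [UU Uf]] := Vcongruence_ultrafilter A hV hLSl.
have k_gt0 := power_length_gt0.
have [f fP] : {f : F -> 'I_k * 'I_k & forall x, Jclass e x -> U (has_type x (f x))}.
  apply: (@choice F ('I_k * 'I_k)%type (fun x ij => Jclass e x -> U (has_type x ij))) => x.
  have [ex|nex] := pselect (Jclass e x); last first.
    by exists (Ordinal k_gt0, Ordinal k_gt0) => /nex.
  have [||ij _ Uij] := @ultra_finite _ _ U [set: 'I_k * 'I_k]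
    (fun c ij => has_type x ij c) UU; last by exists ij.
  - exact: finite_finset.
  - apply: filterS (Uf (level k.+1)) => c /(has_type_ex ex)[ij xij].
    by exists ij.
exists ('I_k * 'I_k)%type, f => x y /fP Ux /fP Uy xy; rewrite -xy in Uy.
have [[t yt] [t' yt']] := has_type_mul UU Uf Ux Uy.
have [[s xs] [s' xs']] := has_type_mul UU Uf Uy Ux.
by split; [exact: greenR_mul yt xs | exact: greenL_mul yt' xs'].
Qed.

End PowerJclass.

(** The relation [R] covers two uses: [C] the class of [x], and [C] the idempotent [x] itself. Each
    member of [S] is recovered from the index of any related [x]. *)
Lemma finite_set_index (X Y : Type) (T : finType) (J : set X) (f : X -> T)
    (S : set Y) (R : X -> Y -> Prop) :
  (forall C, S C -> exists2 x, J x & R x C) ->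
  (forall x y C D, J x -> J y -> S C -> S D -> R x C -> R y D -> f x = f y -> C = D) ->
  finite_set S.
Proof.
move=> SR Rinj; have [[C0 _]|] := pselect (S !=set0); last first.
  by move=> /set0P/negP; rewrite negbK => /eqP ->; exact: finite_set0.
pose Q t C := S C /\ exists x, [/\ J x, R x C & f x = t].
have [g gP] : {g : T -> Y & forall t, (exists C, Q t C) -> Q t (g t)}.
  apply: (@choice T Y (fun t C => (exists C', Q t C') -> Q t C)) => t.
  have [[C QC]|nQ] := pselect (exists C, Q t C); first by exists C.
  by exists C0 => /nQ.
apply: (@sub_finite_set _ _ [set g t | t in [set: T]]); last first.
  by apply: finite_image; exact: finite_finset.
move=> C SC; have [x Jx xC] := SR _ SC; exists (f x) => //.
have [|Sg [y [Jy yg fy]]] := gP (f x); first by exists C; split=> //; exists x.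
exact: Rinj Jy Jx Sg SC yg xC fy.
Qed.

(** * From the finiteness conditions to the omega power, and back *)

Section Bounds.
Variables (V : semigroupType -> Prop) (A : finType).
Hypothesis hV : pseudovariety V.
Hypothesis hLSl : forall S : semigroupType, LSl S -> V S.
Variable e : free_proV V A.
Hypothesis ee : is_idempotent e.
Notation F := (free_proV V A).

(** Each factor of length [n.+1] is the prefix of an idempotent in the J-class of [e], and
    R-equivalent elements share such prefixes. So distinct factors yield distinct values of [cl],
    and the finiteness of [D] bounds their number uniformly in [n]. The map [cl] will be a class map
    or the identity. *)
Lemma finite_greenR_omega (T : choiceType) (D : set T) (cl : F -> T) :
  finite_set D -> (forall f, Jclass e f -> is_idempotent f -> D (cl f)) ->
  (forall f f', cl f = cl f' -> greenR f f') ->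
  exists u, e = omega (of_word V u).
Proof.
move=> /card_le_finite_set[r rP] clD clR.
apply: (bounded_complexity_omega hV (hLSl := hLSl) ee (r := r)) => n.
apply: (rP _ _ (fun z t => exists f, cl f = t /\ (sig hLSl f n.+1).1.1 = val z)).
  by move=> z /(prefix_idempotent hV ee)[f [ff ef fz]]; exists (cl f); [exact: clD | exists f].
move=> z z' t [f [<- fz]] [f' [/esym/clR/greenR_right_ideal + fz']].
case=> [E|[s E]]; apply: val_inj; rewrite -fz -fz' E// sig_prefixM//.
by rewrite fz size_tuple.
Qed.

Lemma finite_greenL_omega (T : choiceType) (D : set T) (cl : F -> T) :
  finite_set D -> (forall f, Jclass e f -> is_idempotent f -> D (cl f)) ->
  (forall f f', cl f = cl f' -> greenL f f') ->
  exists u, e = omega (of_word V u).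
Proof.
move=> /card_le_finite_set[r rP] clD clL.
apply: (bounded_complexity_omega hV (hLSl := hLSl) ee (r := r)) => n.
apply: (rP _ _ (fun z t => exists f, cl f = t /\ (sig hLSl f n.+1).1.2 = val z)).
  by move=> z /(suffix_idempotent hV ee)[f [ff ef fz]]; exists (cl f); [exact: clD | exists f].
move=> z z' t [f [<- fz]] [f' [/esym/clL/greenL_left_ideal + fz']].
case=> [E|[s E]]; apply: val_inj; rewrite -fz -fz' E// sig_suffixM//.
by rewrite fz size_tuple.
Qed.

End Bounds.

Lemma greenH_idempotent (S : semigroupType) (x y : S) :
  is_idempotent x -> is_idempotent y -> greenH x y -> x = y.
Proof.
move=> xx yy [xyR xyL].
have xy : x * y = y.
  by case: (greenR_right_ideal xyR) => [->//|[t ->]]; rewrite mulgA xx.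
rewrite -[RHS]xy; case: (greenL_left_ideal (esym xyL)) => [<-//|[t ->]].
by rewrite -mulgA yy.
Qed.

Section Equivalences.
Variables (V : semigroupType -> Prop) (A : finType).
Hypothesis hV : pseudovariety V.
Hypothesis hLSl : forall S : semigroupType, LSl S -> V S.
Hypothesis hA : (0 < #|A|)%N.
Variable e : free_proV V A.
Hypothesis ee : is_idempotent e.
Notation F := (free_proV V A).

Lemma omega_finite (Y : Type) (S : set Y) (R : F -> Y -> Prop) :
  (exists u, e = omega (of_word V u)) ->
  (forall C, S C -> exists2 x, Jclass e x & R x C) ->
  (forall x y C D, greenH x y -> S C -> S D -> R x C -> R y D -> C = D) ->
  finite_set S.
Proof.
move=> [u /(omegaP hV hLSl u ee) eu] SR Rinj; have [a0 _] := card_gt0P hA.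
have [T [f fP]] := finite_index_greenH hV hLSl a0 ee eu.
apply: (finite_set_index (J := Jclass e) (f := f) SR) => x y C D ex ey SC SD xC yD fxy.
exact: Rinj (fP _ _ ex ey fxy) SC SD xC yD.
Qed.

Lemma finite_classes_omega (cls : F -> set F) :
  (forall f, cls f f) -> (forall f g, cls f g -> greenJ f g) ->
  (forall f g, cls f g -> greenR f g) \/ (forall f g, cls f g -> greenL f g) ->
  finite_set [set C | C `<=` Jclass e /\ exists x, C = cls x] ->
  exists u, e = omega (of_word V u).
Proof.
move=> clsxx clsJ clsRL fin.
have D f : Jclass e f -> is_idempotent f ->
    [set C | C `<=` Jclass e /\ exists x, C = cls x] (cls f).
  move=> ef _; split; last by exists f.
  by move=> g /clsJ fg; rewrite /Jclass/= /greenJ [twosided_ideal e]ef.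
have cls_eq f f' : cls f = cls f' -> cls f f' by move=> ->.
by case: clsRL => cls_sub; [apply: (finite_greenR_omega hV hLSl ee fin D)
  | apply: (finite_greenL_omega hV hLSl ee fin D)] => f f' /cls_eq /cls_sub.
Qed.

Lemma omega_finite_classes (cls : F -> set F) :
  (forall f, cls f f) -> (forall f g, greenH f g -> cls f = cls g) ->
  (exists u, e = omega (of_word V u)) ->
  finite_set [set C | C `<=` Jclass e /\ exists x, C = cls x].
Proof.
move=> clsxx Hcls eu; apply: (omega_finite (R := fun x C => C = cls x) eu).
  by move=> C [Ce [x Cx]]; exists x => //; apply: Ce; rewrite Cx.
by move=> x y C D xy _ _ -> ->; exact: Hcls.
Qed.

End Equivalences.

Theorem proposition7p8 (V : semigroupType -> Prop) (hV : pseudovariety V)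
    (hLSl : forall S : semigroupType, LSl S -> V S)
    (A : finType) (hA : (0 < #|A|)%N)
    (e : free_proV V A) (he : is_idempotent e) :
  [<-> (exists u : word A, e = omega (of_word V u));
       finite_set [set C | C `<=` Jclass e /\ exists x, C = Hclass x];
       finite_set [set C | C `<=` Jclass e /\ exists x, C = Rclass x];
       finite_set [set C | C `<=` Jclass e /\ exists x, C = Lclass x];
       finite_set [set x | Jclass e x /\ is_idempotent x]].
Proof.
have RJ (f g : free_proV V A) : greenR f g -> greenJ f g by exact: greenR_sub_greenJ.
have LJ (f g : free_proV V A) : greenL f g -> greenJ f g by exact: greenL_sub_greenJ.
have HR (f g : free_proV V A) : greenH f g -> Rclass f = Rclass g.
  by case=> fg _; rewrite /Rclass /greenR fg.
have HL (f g : free_proV V A) : greenH f g -> Lclass f = Lclass g.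
  by case=> _ fg; rewrite /Lclass /greenL fg.
have HH (f g : free_proV V A) : greenH f g -> Hclass f = Hclass g.
  by case=> fgR fgL; rewrite /Hclass /greenH /greenR /greenL fgR fgL.
have H1 := @finite_classes_omega V A hV hLSl e he (@Hclass _).
have R1 := @finite_classes_omega V A hV hLSl e he (@Rclass _).
have L1 := @finite_classes_omega V A hV hLSl e he (@Lclass _).
have finH := @omega_finite_classes V A hV hLSl hA e he.
(* The implications run in a cycle, but each of the three middle ones first returns to [e] being an
   omega power and derives the next condition from that. *)
tfae.
- exact: finH.
- move=> /H1 eu; apply: finH => //; apply: eu => //; first by move=> f g [/RJ].
  by left => f g [].
- by move=> /R1 eu; apply: finH => //; apply: eu => //; left.
- move=> /L1 eu.
  have : exists u, e = omega (of_word V u) by apply: eu => //; right.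
  move=> /(omega_finite hV hLSl hA he (S := [set x | Jclass e x /\ is_idempotent x])).
  move=> /(_ (fun x y => x = y)); apply.
    by move=> x [ex xx]; exists x.
  move=> x y C D xy [_ xx] [_ yy] xC yD; rewrite -xC -yD.
  by apply: greenH_idempotent xy; rewrite ?xC ?yD.
(* Idempotents are counted directly: [cl] is the identity, and equal elements are R-equivalent. *)
- move=> fin; apply: (finite_greenR_omega hV hLSl he fin (cl := id)) => //.
  by move=> f f' /= ->.
Qed.
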